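(* Let $(X,r)$ be a solution whose permutation left brace $B=\mathcal{G}(X,r)$ is finite. Then the Dehornoy's class of $(X,r)$ is equal to the maximum of the set $\{o(x)_+\mid x\in B\}$, where $o(x)_+$ is the order of $x$ in the additive group $(B,+)$.
   Context: A solution is a pair $(X,r)$ with $X$ a non-empty set and $r:X\times X\to X\times X$, $r(x,y)=(\sigma_x(y),\tau_y(x))$, such that $(r\times \mathrm{id})(\mathrm{id}\times r)(r\times \mathrm{id})=(\mathrm{id}\times r)(r\times \mathrm{id})(\mathrm{id}\times r)$ on $X^3$, $r^2=\mathrm{id}$ (involutive), and all maps $\sigma_x,\tau_y:X\to X$ are bijections (non-degenerate). The permutation group $\mathcal{G}(X,r)$ is the subgroup of $\mathrm{Sym}(X)$ generated by all $\sigma_x$. A left brace is a set $B$ with two operations $+,\circ$ such that $(B,+)$ is an abelian group, $(B,\circ)$ is a group and $a\circ(b+c)=a\circ b-a+a\circ c$ for all $a,b,c$. Put $\lambda_a(b)=-a+a\circ b$. The permutation left brace of $(X,r)$ is $\mathcal{G}(X,r)$ with $\circ$ equal to composition and with the unique addition making it a left brace such that $\lambda_g(\sigma_x)=\sigma_{g(x)}$ for all $g\in\mathcal{G}(X,r)$, $x\in X$. Dehornoy's class: set $x\cdot y=\sigma_x^{-1}(y)$ and define $\Omega_n:X^n\to X$ by $\Omega_1(x_1)=x_1$ and $\Omega_n(x_1,\dots,x_n)=\Omega_{n-1}(x_1,\dots,x_{n-1})\cdot\Omega_{n-1}(x_1,\dots,x_{n-2},x_n)$ for $n>1$. The Dehornoy's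 class of $(X,r)$ is the minimal positive integer $d$ such that $\Omega_{d+1}(x,x,\dots,x,y)=y$ for all $x,y\in X$. *)

(* Defs.v *)
From HB Require Import structures.
From mathcomp Require Import all_boot all_order all_algebra.
From mathcomp Require Import boolp classical_sets cardinality.

Set Implicit Arguments.
Unset Strict Implicit.
Unset Printing Implicit Defensive.

Import GRing.Theory.

Local Open Scope classical_set_scope.

(* The group Sym(X), for an arbitrary, possibly infinite, type X. Its product
   is composition of functions, (f * g) x = f (g x); beware that the product
   of the library type {perm T} composes in the opposite order. *)

Section Sym.
Variable X : Type.

Record sym := Sym { sym_fun :> X -> X; sym_bij : `[< bijective sym_fun >] }.

HB.instance Definition _ := [isSub for sym_fun].
HB.instance Definition _ := gen_eqMixin sym.
HB.instance Definition _ := gen_choiceMixin sym.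

Lemma symP (f g : sym) : f =1 g -> f = g.
Proof. by move=> fg; apply: val_inj; apply/funext. Qed.

Lemma sym_inv_subproof (f : sym) : {g : X -> X | cancel f g /\ cancel g f}.
Proof. by apply: cid; have /asboolP[g fK gK] := sym_bij f; exists g. Qed.

Lemma sym_one_bij : `[< bijective (@id X) >].
Proof. by apply/asboolP; exists id. Qed.

Lemma sym_mul_bij (f g : sym) : `[< bijective (f \o g) >].
Proof.
by apply/asboolP/bij_comp; apply/asboolP; apply: sym_bij.
Qed.

Lemma sym_inv_bij (f : sym) : `[< bijective (sval (sym_inv_subproof f)) >].
Proof.
by case: sym_inv_subproof => g /= [fK gK]; apply/asboolP; exists f.
Qed.

Definition sym_one := Sym sym_one_bij.
Definition sym_mul (f g : sym) := Sym (sym_mul_bij f g).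
Definition sym_inv (f : sym) := Sym (sym_inv_bij f).

Lemma sym_mulA : associative sym_mul.
Proof. by move=> f g h; apply: symP. Qed.

Lemma sym_mul1 : left_id sym_one sym_mul.
Proof. by move=> f; apply: symP. Qed.

Lemma sym_mulr1 : right_id sym_one sym_mul.
Proof. by move=> f; apply: symP. Qed.

Lemma sym_mulV : left_inverse sym_one sym_inv sym_mul.
Proof.
move=> f; apply: symP => x /=.
by case: sym_inv_subproof => g /= [fK _]; apply: fK.
Qed.

Lemma sym_mulrV : right_inverse sym_one sym_inv sym_mul.
Proof.
move=> f; apply: symP => x /=.
by case: sym_inv_subproof => g /= [_ gK]; apply: gK.
Qed.

HB.instance Definition _ :=
  isGroup.Build sym sym_mulA sym_mul1 sym_mulr1 sym_mulV sym_mulrV.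

End Sym.

Definition generated_subgroup (G : groupType) (A : set G) : set G :=
  smallest (fun H : set G => group_closed (fun x => x \in H)) A.

Lemma generated_subgroup_closed (G : groupType) (A : set G) :
  group_closed (fun x => x \in generated_subgroup A).
Proof.
split; first by apply/mem_set => H [[/set_mem H1 _] _].
move=> x y /set_mem Hx /set_mem Hy; apply/mem_set => H HA.
have [[_ Hdiv] _] := HA.
by apply/set_mem/Hdiv; apply/mem_set; [apply: Hx | apply: Hy].
Qed.

(* A solution (X, r), with r (x, y) = (sigma_x y, tau_y x). *)

Definition braid12 (X : Type) (r : X * X -> X * X) (t : X * X * X) :=
  let: (x, y, z) := t in let: (x', y') := r (x, y) in (x', y', z).

Definition braid23 (X : Type) (r : X * X -> X * X) (t : X * X * X) :=
  let: (x, y, z) := t in let: (y', z') := r (y, z) in (x, y', z').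

Record solution (X : Type) := Solution {
  sol_map : X * X -> X * X;
  sol_inhabited : inhabited X;
  sol_braid : braid12 sol_map \o braid23 sol_map \o braid12 sol_map
           =1 braid23 sol_map \o braid12 sol_map \o braid23 sol_map;
  sol_involutive : involutive sol_map;
  sol_sigma_bij : forall x, bijective (fun y => (sol_map (x, y)).1);
  sol_tau_bij : forall y, bijective (fun x => (sol_map (x, y)).2)
}.

Section Solution.
Variables (X : Type) (S : solution X).

Definition sigma (x : X) : sym X := Sym (asboolT (sol_sigma_bij S x)).

Definition permgroup_set : set (sym X) := generated_subgroup (range sigma).

Record permgroup := Permgroup {
  permgroup_val :> sym X;
  permgroup_valP : permgroup_val \in permgroup_set
}.

HB.instance Definition _ := [isSub for permgroup_val].
HB.instance Definition _ := [Choice of permgroup by <:].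
HB.instance Definition _ := SubChoice_isSubGroup.Build
  (sym X) (fun f => f \in permgroup_set) permgroup
  (generated_subgroup_closed (range sigma)).

Lemma sigma_in_permgroup x : sigma x \in permgroup_set.
Proof. by apply/mem_set => H [_]; apply; exists x. Qed.

Definition permgroup_sigma (x : X) : permgroup :=
  Permgroup (sigma_in_permgroup x).

Definition sol_dot (x y : X) : X := (sigma x)^-1%g y.

(* Omega n is the map Omega_(n+1) : X^(n+1) -> X; 'lift j' is the order
   embedding whose image omits the index j. Here the first recursive call drops
   the last argument and the second one drops the last but one. *)
Fixpoint Omega (n : nat) : ('I_n.+1 -> X) -> X :=
  match n with
  | 0 => fun x => x ord0
  | m.+1 => fun x =>
      sol_dot (Omega (fun i : 'I_m.+1 => x (lift ord_max i)))
              (Omega (fun i : 'I_m.+1 => x (lift (inord m) i)))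
  end.

End Solution.

Definition is_minimum (A : set nat) (n : nat) := A n /\ lbound A n.
Definition is_maximum (A : set nat) (n : nat) := A n /\ ubound A n.

Definition is_dehornoy_class (X : Type) (S : solution X) (d : nat) :=
  is_minimum
    [set n | 0 < n /\
       forall x y : X, Omega S (fun i : 'I_n.+1 => if i == ord_max then y else x)
                       = y] d.

(* A left brace: + is the operation of the zmodType structure and the circle
   operation is the product of the groupType structure. *)

HB.mixin Record isLeftBrace B of GRing.Zmodule B & Group B := {
  brace_distr : forall a b c : B,
    (a * (b + c)%R)%g = ((a * b)%g - a + (a * c)%g)%R
}.

#[short(type="leftBraceType")]
HB.structure Definition LeftBrace :=
  {B of isLeftBrace B & GRing.Zmodule B & Group B}.

Definition lambda (B : leftBraceType) (a b : B) : B := (- a + (a * b)%g)%R.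

Definition is_additive_order (B : leftBraceType) (a : B) (n : nat) :=
  is_minimum [set m | 0 < m /\ (a *+ m = 0)%R] n.

(* An addition A on a given group G, and the alias brace_of A of G that carries
   both the given group structure and the addition A. *)

Record braceAddition (G : groupType) := BraceAddition {
  badd : G -> G -> G;
  bopp : G -> G;
  bzero : G;
  baddA : associative badd;
  baddC : commutative badd;
  badd0 : left_id bzero badd;
  baddN : left_inverse bzero bopp badd;
  badd_distr : forall a b c : G,
    (a * badd b c)%g = badd (badd (a * b)%g (bopp a)) (a * c)%g
}.

Definition brace_of (G : groupType) (A : braceAddition G) : Type := G.

Section BraceOf.
Variables (G : groupType) (A : braceAddition G).

HB.instance Definition _ := Group.copy (brace_of A) G.
HB.instance Definition _ := GRing.isZmodule.Build (brace_of A)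
  (@baddA G A) (@baddC G A) (@badd0 G A) (@baddN G A).
HB.instance Definition _ := isLeftBrace.Build (brace_of A) (@badd_distr G A).

End BraceOf.

(* The condition lambda_g (sigma_x) = sigma_(g x). At most one addition on the
   permutation group satisfies it, since g + sigma_x = g * sigma_(g^-1 x) and
   the sigma_x generate; it is the addition of the permutation left brace. *)
Definition is_permutation_addition (X : Type) (S : solution X)
    (A : braceAddition (permgroup S)) :=
  forall (g : permgroup S) (x : X),
    lambda (g : brace_of A) (permgroup_sigma S x : brace_of A)
    = permgroup_sigma S (g x).

(* Main.v *)
From HB Require Import structures.
Require Import Defs.
From mathcomp Require Import all_boot all_order all_algebra.
From mathcomp Require Import all_fingroup all_solvable.
From mathcomp Require Import boolp classical_sets cardinality.

(** The maps of Dehornoy's calculus are multiples in the permutation brace: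
    [Omega_(n+1) (x, ..., x, y) = (n sigma_x)^-1 y], where [n sigma_x] is an
    additive multiple, evaluated as a permutation ([Omega_mulrn_sigma]). This
    comes from [g + sigma_x = g o sigma_(g^-1 x)], which is the defining
    property of the addition.  Hence the identity [Omega_(n+1) (x, ..., x, y)
    = y] holds for all [x] and [y] exactly when [n] annihilates every
    [sigma_x] in [(B, +)].

    The elements annihilated by [n] form an additive subgroup stable under all
    [lambda_g]; such a subgroup is also a subgroup for the circle operation.
    As the [sigma_x] generate the circle group, [n] annihilates all [sigma_x]
    only if it annihilates [B] ([mulrn_permgroup_eq0]).  So the Dehornoy class
    is the exponent of the finite abelian group [(B, +)], and in such a group
    the exponent is the order of some element ([finite_zmod_exponent]), hence
    the largest order. *)

Set Implicit Arguments.
Unset Strict Implicit.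
Unset Printing Implicit Defensive.

Import GRing.Theory.

Local Open Scope classical_set_scope.
Local Open Scope ring_scope.

(** In a finite nilpotent group the exponent is the order of an element; here
    this is read in the additive group of [W]. *)
Lemma finZmod_exponent (W : finZmodType) :
  exists (a : W) (d : nat),
    [/\ (0 < d)%N, forall n, a *+ n = 0 -> (d %| n)%N
      & forall b : W, b *+ d = 0].
Proof.
have nilW : nilpotent [set: W]%SET by apply/abelian_nil/FinRing.zmod_abelian.
have [a _ expE] := exponent_witness nilW.
exists a, #[a]%g; split; first exact: order_gt0.
  by move=> n an0; rewrite order_dvdn FinRing.zmodXgE; apply/eqP.
by move=> b; rewrite -FinRing.zmodXgE -expE expg_exponent ?inE.
Qed.

(** An enumeration of [V] makes it countable, through the position of an
    element, and then finite; so the theory of finite groups applies to it. *)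
Lemma finite_zmod_exponent (V : zmodType) : finite_set [set: V] ->
  exists (a : V) (d : nat),
    [/\ (0 < d)%N, forall n, a *+ n = 0 -> (d %| n)%N
      & forall b : V, b *+ d = 0].
Proof.
move=> /finite_seqP[s Vs].
have sP (v : V) : v \in s by have : [set: V] v by []; rewrite Vs.
have posK : pcancel (index^~ s) (onth s).
  by move=> v; rewrite onthE (nth_map v) ?index_mem // nth_index.
have enumP : Finite.axiom (undup s).
  by move=> v; rewrite count_uniq_mem ?undup_uniq // mem_undup sP.
pose cT : countType := HB.pack V (PCanIsCountable posK).
pose W : finZmodType := HB.pack V cT (isFinite.Build V enumP).
exact: (finZmod_exponent W).
Qed.

Section LeftBrace.
Variable B : leftBraceType.
Implicit Types a b c : B.

Lemma brace_mulr0 a : (a * 0)%g = a.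
Proof.
have := brace_distr a 0 0; rewrite addr0 -addrA => /eqP.
by rewrite -[X in X == _]addr0 (inj_eq (addrI _)) eq_sym addrC subr_eq0 => /eqP.
Qed.

Lemma brace_zero_one : 0 = 1%g :> B.
Proof. by rewrite -[0](mul1g (0 : B)) brace_mulr0. Qed.

Lemma brace_mulE a b : (a * b)%g = a + lambda a b.
Proof. by rewrite /lambda addrA subrr add0r. Qed.

Lemma lambda0 a : lambda a 0 = 0.
Proof. by rewrite /lambda brace_mulr0 addNr. Qed.

Lemma lambdaD a b c : lambda a (b + c) = lambda a b + lambda a c.
Proof. by rewrite /lambda brace_distr !addrA. Qed.

Lemma lambda_mulrn a b n : lambda a (b *+ n) = lambda a b *+ n.
Proof. by elim: n => [|n IHn]; rewrite ?lambda0 // !mulrS lambdaD IHn. Qed.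

(** [a o b = a + lambda_a b] and [lambda_a] is additive, so the
    annihilator of [n] is closed under the circle operation. *)
Lemma mulrn_mulg_eq0 a b n : a *+ n = 0 -> b *+ n = 0 -> (a * b)%g *+ n = 0.
Proof.
by move=> an0 bn0; rewrite brace_mulE mulrnDl an0 add0r -lambda_mulrn bn0 lambda0.
Qed.

Lemma mulrn_invg_eq0 a n : a *+ n = 0 -> (a^-1)%g *+ n = 0.
Proof.
move=> an0.
(* Since 0 = 1, a^-1 o a = 1 says that a^-1 is the opposite of
   lambda_(a^-1) a. *)
have : a^-1%g + lambda a^-1%g a = 0 by rewrite -brace_mulE mulVg brace_zero_one.
move/eqP; rewrite addr_eq0 => /eqP ->.
by rewrite mulNrn -lambda_mulrn an0 lambda0 oppr0.
Qed.

End LeftBrace.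

Section PermutationGroup.
Variables (X : Type) (S : solution X).

Lemma permgroup_gen_ind (P : permgroup S -> Prop) :
  P 1%g -> (forall g h, P g -> P h -> P (g * h^-1)%g) ->
  (forall x, P (permgroup_sigma S x)) -> forall g, P g.
Proof.
move=> P1 Pdiv Psigma g.
(* Generation is stated among subsets of Sym(X), so P is transported there. *)
pose H : set (sym X) := [set f | exists2 h : permgroup S, val h = f & P h].
have [h /val_inj <- //] : H (val g).
have /set_mem := permgroup_valP g; apply; split; last first.
  by move=> _ [x _ <-]; exists (permgroup_sigma S x).
split; first by apply/mem_set; exists 1%g.
move=> _ _ /set_mem[h <- Ph] /set_mem[k <- Pk]; apply/mem_set.
by exists (h * k^-1)%g; [|exact: Pdiv].
Qed.

(** All entries but the last are equal, so dropping the last one leaves a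
    constant tuple, of the same shape with [y = x], and dropping the last but
    one only shortens the run of [x]. *)
Lemma OmegaS n (x y : X) :
  let w n y := Omega S (fun i : 'I_n.+1 => if i == ord_max then y else x) in
  w n.+1 y = sol_dot S (w n x) (w n y).
Proof.
rewrite /=; congr sol_dot; congr Omega; apply/funext => i.
  by rewrite eq_sym (negPf (neq_lift _ _)) if_same.
have [->|i_neq] := eqVneq i ord_max.
  rewrite ifT //; apply/eqP/val_inj.
  by rewrite /= inordK // /bump leqnn.
rewrite ifF //; apply/negbTE; apply: contra i_neq => /eqP/(congr1 val) /=.
rewrite inordK // /bump => iE; apply/eqP/val_inj => /=.
case: leqP iE => [_ []|i_lt] //.
by rewrite add0n => iE; move: i_lt; rewrite iE ltnNge leqnSn.
Qed.

End PermutationGroup.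

Section PermutationBrace.
Variables (X : Type) (S : solution X) (A : braceAddition (permgroup S)).
Hypothesis hA : is_permutation_addition A.

Let s (x : X) : brace_of A := permgroup_sigma S x.

(** [g o s_(g^-1 x) = g + lambda_g (s_(g^-1 x)) = g + s_x]: adding a generator
    amounts to composing with another generator. *)
Lemma addr_sigma (g : brace_of A) (x : X) :
  g + s x = (g * s ((g : permgroup S)^-1%g x))%g.
Proof.
rewrite brace_mulE [lambda _ _]hA; congr (_ + s _).
by rewrite -[RHS]/((val (g : permgroup S) * (val (g : permgroup S))^-1)%g x) mulgV.
Qed.

(** Put [g = n s_x]. By induction [Omega_(n+1)] takes the value [t = g^-1 x] at
    the constant tuple, so one more step applies [s_t^-1] to [g^-1 y]; and
    [g o s_t = g + s_x] is the next multiple. *)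
Lemma Omega_mulrn_sigma n (x y : X) :
  Omega S (fun i : 'I_n.+1 => if i == ord_max then y else x)
  = ((s x *+ n : permgroup S)^-1)%g y.
Proof.
elim: n y => [|n IHn] y.
  rewrite mulr0n brace_zero_one.
  by rewrite [(_^-1)%g]invg1.
rewrite OmegaS !IHn mulrSr addr_sigma.
by rewrite [in RHS]invMg.
Qed.

Lemma Omega_id_mulrn_sigma n :
  (forall x y : X,
    Omega S (fun i : 'I_n.+1 => if i == ord_max then y else x) = y)
  <-> (forall x : X, s x *+ n = 0).
Proof.
split=> [Omega_id x|sn0 x y]; last first.
  by rewrite Omega_mulrn_sigma sn0 brace_zero_one [(_^-1)%g]invg1.
rewrite brace_zero_one; apply: (@invg_inj (permgroup S)).
rewrite invg1; apply/val_inj/symP => y.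
by rewrite -[LHS]Omega_mulrn_sigma Omega_id.
Qed.

(** The annihilator of [n] is a subgroup for the circle operation, and the
    [s_x] generate the circle group. *)
Lemma mulrn_permgroup_eq0 n :
  (forall x : X, s x *+ n = 0) -> forall b : brace_of A, b *+ n = 0.
Proof.
move=> sn0; apply: (@permgroup_gen_ind X S (fun b => (b : brace_of A) *+ n = 0)) => //.
  by rewrite -[X in X *+ n]/(1%g : brace_of A) -brace_zero_one mul0rn.
by move=> g h gn0 hn0; apply: mulrn_mulg_eq0 => //; apply: mulrn_invg_eq0.
Qed.

End PermutationBrace.

Theorem corollary5p5 (X : Type) (S : solution X)
    (A : braceAddition (permgroup S)) (hA : is_permutation_addition A)
    (hfin : finite_set [set: brace_of A]) :
  exists d : nat,
    is_dehornoy_class S d /\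
    is_maximum [set n | exists a : brace_of A, is_additive_order a n] d.
Proof.
have [a [d [d_gt0 a_order d_kills]]] := finite_zmod_exponent hfin.
exists d; split; split.
- by split=> //; apply/(Omega_id_mulrn_sigma hA) => x; apply: d_kills.
- move=> n [n_gt0 /(Omega_id_mulrn_sigma hA)/mulrn_permgroup_eq0 n_kills].
  by apply: dvdn_leq n_gt0 (a_order _ (n_kills a)).
- exists a; split; first by split; [|exact: d_kills].
  by move=> n [n_gt0 an0]; apply: dvdn_leq n_gt0 (a_order _ an0).
- by move=> n [b [_ b_min]]; apply: b_min; split; [|exact: d_kills].
Qed.
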